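(* Let $\mathcal{M}_1,\ldots,\mathcal{M}_k$ be graph matroid families and let $\mathcal{M}$ be their union. If each of $\mathcal{M}_1,\ldots,\mathcal{M}_k$ has the Lovász-Yemini property, then so does $\mathcal{M}$.
   Context: All graphs are finite and simple and have no isolated vertices. A graph matroid family $\mathcal{M}$ assigns to every graph $G$ a matroid $\mathcal{M}(G)$ on $E(G)$ such that (i) every graph isomorphism $V(G)\to V(H)$ induces an isomorphism $\mathcal{M}(G)\to\mathcal{M}(H)$, and (ii) for every subgraph $H$ of $G$, $\mathcal{M}(H)$ is the restriction of $\mathcal{M}(G)$ to $E(H)$. The union $\mathcal{M}$ of $\mathcal{M}_1,\dots,\mathcal{M}_k$ is given by $\mathcal{M}(G)=\bigcup_i\mathcal{M}_i(G)$ (matroid union). A graph $G$ is $\mathcal{M}$-rigid if the rank of $\mathcal{M}(G)$ equals the rank of $\mathcal{M}(K_{V(G)})$, where $K_V$ denotes the complete graph on $V$. $\mathcal{M}$ has the Lovász-Yemini property if there is a nonnegative integer $c$ such that every $c$-connected graph is $\mathcal{M}$-rigid. *)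

(* Defs.v *)
From HB Require Import structures.
From mathcomp Require Import all_boot finmap.

Set Implicit Arguments.
Unset Strict Implicit.
Unset Printing Implicit Defensive.

Local Open Scope fset_scope.

(* Vertices are natural numbers (every finite graph is isomorphic to one of
   these; graph matroid families are isomorphism invariant).  An edge {u,v}
   is stored as the ordered pair (u,v) with u < v.  A graph without isolated
   vertices is determined by its (finite) edge set. *)
Definition edge := (nat * nat)%type.

Definition simple_graph (G : {fset edge}) : Prop :=
  forall e, e \in G -> e.1 < e.2.

Definition verts (G : {fset edge}) : {fset nat} :=
  [fset e.1 | e in G] `|` [fset e.2 | e in G].

Definition Kgraph (V : {fset nat}) : {fset edge} :=
  [fset e in [fset ((u, v) : edge) | u : nat in V, v : nat in V] | e.1 < e.2].

Definition map_edge (f : nat -> nat) (e : edge) : edge :=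
  (minn (f e.1) (f e.2), maxn (f e.1) (f e.2)).

Definition is_matroid (E : {fset edge}) (ind : {fset edge} -> Prop) : Prop :=
  [/\ forall I, ind I -> I `<=` E,
      ind fset0,
      forall I J, ind I -> J `<=` I -> ind J &
      forall I J, ind I -> ind J -> #|` I| < #|` J| ->
        exists2 e, e \in J `\` I & ind (e |` I)].

Record graph_matroid_family := GMF {
  gmf_ind : {fset edge} -> {fset edge} -> Prop;
  gmf_matroid : forall G, simple_graph G -> is_matroid G (gmf_ind G);
  gmf_iso : forall (G : {fset edge}) (f : nat -> nat),
      simple_graph G -> {in verts G &, injective f} ->
      forall I, I `<=` G ->
        (gmf_ind (map_edge f @` G) (map_edge f @` I) <-> gmf_ind G I);
  gmf_restr : forall G H, simple_graph G -> H `<=` G ->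
      forall I, gmf_ind H I <-> (gmf_ind G I /\ I `<=` H)
}.

Definition rank_is (ind : {fset edge} -> Prop) (E : {fset edge}) (r : nat) :=
  (exists I, [/\ I `<=` E, ind I & #|` I| = r]) /\
  (forall I, I `<=` E -> ind I -> #|` I| <= r).

Definition union_ind (k : nat) (Ms : 'I_k -> graph_matroid_family)
    (G I : {fset edge}) : Prop :=
  exists Is : 'I_k -> {fset edge},
    (forall i, gmf_ind (Ms i) G (Is i)) /\ I = \bigcup_(i <- enum 'I_k) Is i.

Definition rigid (ind : {fset edge} -> {fset edge} -> Prop) (G : {fset edge}) :=
  exists r, rank_is (ind G) G r /\
            rank_is (ind (Kgraph (verts G))) (Kgraph (verts G)) r.

Definition adj_avoid (G : {fset edge}) (X : {fset nat}) (x y : nat) : bool :=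
  (((x, y) \in G) || ((y, x) \in G)) && (y \notin X).

Definition c_connected (c : nat) (G : {fset edge}) : Prop :=
  c < #|` verts G| /\
  forall X : {fset nat}, X `<=` verts G -> #|` X| < c ->
    forall u v, u \in verts G `\` X -> v \in verts G `\` X ->
      exists p : seq nat, path (adj_avoid G X) u p /\ last u p = v.

Definition lovasz_yemini (ind : {fset edge} -> {fset edge} -> Prop) : Prop :=
  exists c : nat, forall G, simple_graph G -> c_connected c G -> rigid ind G.

(* Main.v *)
Require Import Defs.
From mathcomp Require Import all_boot fingroup perm finmap zify boolp.

(** The rank [r] of a graph matroid family whose [K_{T,T}] is rigid behaves as follows: any
    graph containing [K_{T,T}] has the clique on these vertices in its closure, so
    [r(K_n)] eventually grows with a constant slope [d], a new vertex with at least [2T]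
    neighbours raises the rank by at least [d], and it raises it by at least [d + 1] if two
    of its neighbours are not joined in the closure.  Let [G] be highly connected, non-rigid
    and closed.  If the neighbours of some vertex form a clique, this vertex is deleted and
    one argues by induction.  Otherwise one adds the vertices in a uniformly random order:
    with high probability a vertex has at least [2T] earlier neighbours, and with probability
    [1/3] two given non-adjacent neighbours come earlier, so the expected rank is at least
    [(d + 1/6) n], which exceeds [r(K_n)].  (The random order is inspired by Villanyi's proof
    for rigidity matroids.)  A union of families satisfies the matroid axioms, and a large
    [K_{T,T}] splits into [k] highly connected spanning subgraphs, one for each family, which
    makes it rigid for the union. *)

Set Implicit Arguments.
Unset Strict Implicit.
Unset Printing Implicit Defensive.

(** * Random orders *)

Section RandomOrder.
Variable V : finType.

Definition before (p : V -> nat) (v : V) : {set V} := [set u | p u < p v].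

Lemma telescope_order (p : V -> nat) (g : {set V} -> nat) (D : nat) (loss : V -> nat) :
  injective p ->
  (forall v, g (before p v) + D <= g (v |: before p v) + loss v) ->
  #|V| * D <= g [set: V] + \sum_v loss v.
Proof.
move=> injp Hg; pose S m := [set u | p u < m].
have HS m : #|S m| * D <= g (S m) + \sum_(v in S m) loss v.
  elim: m => [|m IHm].
    by rewrite (_ : S 0 = set0) ?cards0 //; apply/setP => u; rewrite !inE.
  have [v /eqP pv|noV] := pickP (fun v => p v == m); last first.
    suff -> : S m.+1 = S m by [].
    by apply/setP => u; rewrite !inE ltnS leq_eqVlt noV.
  have vS : v \notin S m by rewrite inE pv ltnn.
  have -> : S m.+1 = v |: S m.
    by apply/setP => u; rewrite !inE ltnS leq_eqVlt -pv (inj_eq injp).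
  rewrite cardsU1 vS big_setU1 //=; have := Hg v.
  rewrite /before pv -/(S m); lia.
have := HS (\max_v p v).+1.
rewrite (_ : S _ = [set: V]) ?cardsT ?(eq_bigl predT) // => [v|].
  by rewrite inE.
by apply/setP => v; rewrite !inE ltnS leq_bigmax.
Qed.

Definition perm_pos (s : {perm V}) (v : V) : nat := enum_rank (s v).

Lemma perm_pos_inj s : injective (perm_pos s).
Proof. by move=> u v /ord_inj/enum_rank_inj/perm_inj. Qed.

Lemma card_early_leq (p : V -> nat) (W : {set V}) t : injective p ->
  #|[set w in W | #|W :&: before p w| < t]| <= t.
Proof.
move=> injp; set X := [set w in W | _].
have [->|[w0 w0X]] := set_0Vmem X; first by rewrite cards0.
(* The latest member of [X] has all other members before it. *)
pose w := [arg max_(w > w0 in X) p w].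
have [wX maxw] : w \in X /\ forall u, u \in X -> p u <= p w.
  by rewrite /w; case: arg_maxnP.
have : X :\ w \subset W :&: before p w.
  apply/subsetP => u; rewrite !inE => /and3P[neuw uW lt].
  rewrite uW ltn_neqAle (inj_eq injp) neuw /=; apply: maxw.
  by rewrite inE uW.
move=> /subset_leq_card; move: (wX); rewrite inE => /andP[_ ltt].
by rewrite (cardsD1 w X) wX => le; apply: leq_ltn_trans le ltt.
Qed.

(* All elements of [W] are equally likely to be among the first [t] of [W]. *)
Lemma sum_early_leq (W : {set V}) (v : V) t : v \in W ->
  #|W| * (\sum_(s : {perm V}) (#|W :&: before (perm_pos s) v| < t)) <= t * #|{perm V}|.
Proof.
move=> vW; rewrite -sum_nat_const.
have sym w : w \in W -> \sum_(s : {perm V}) (#|W :&: before (perm_pos s) v| < t) =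
    \sum_(s : {perm V}) (#|W :&: before (perm_pos s) w| < t).
  (* Multiplying by the transposition of [v] and [w] permutes the orders and exchanges the positions
     of these two elements. *)
  move=> wW; rewrite (reindex_inj (mulgI (tperm v w))) /=.
  apply: eq_bigr => s _; congr (nat_of_bool (_ < t)).
  rewrite -(card_imset (mem (W :&: before (perm_pos s) w)) (@perm_inj _ (tperm v w))).
  apply: eq_card => u; rewrite -[in RHS](tpermK v w u) (mem_imset _ _ perm_inj) !inE.
  rewrite /perm_pos !permM tpermL; congr andb.
  by case: tpermP => [->|->|_ _]; rewrite ?vW ?wW.
rewrite (eq_bigr _ sym) exchange_big /= mulnC -sum_nat_const; apply: leq_sum => s _.
apply: leq_trans (card_early_leq W t (perm_pos_inj (s := s))).
rewrite -sum1_card big_mkcond [X in _ <= X]big_mkcond /=; apply: leq_sum => w _.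
by rewrite inE; case: (w \in W) => //=; case: (_ < t).
Qed.

(** Averaged over all orders, the penalty at [v] is at most 2/3 for the pair [x v], [y v] and at
    most 1/6 for having fewer than [t] earlier neighbours. The mean increment is thus at least
    [d + 1 - 5/6]; the factor 6 clears denominators. *)
Lemma random_order_bound (g : {set V} -> nat) (d t : nat) (nb : V -> {set V}) (x y : V -> V) :
  0 < t ->
  (forall v, [/\ v \notin nb v, x v != y v, x v != v & y v != v]) ->
  (forall v, 6 * d.+1 * t <= #|nb v|.+1) ->
  (forall v (S : {set V}), v \notin S ->
     g S + d.+1 <= g (v |: S) +
       (~~ ((x v \in S) && (y v \in S)) + d.+1 * (#|nb v :&: S| < t))) ->
  (6 * d + 1) * #|V| <= 6 * g [set: V].
Proof.
move=> t_gt0 Hv Hdeg Hg; pose P := #|{perm V}|.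
have P_gt0 : 0 < P by apply/card_gt0P; exists 1%g.
pose l1 (s : {perm V}) v := nat_of_bool
  (~~ ((x v \in before (perm_pos s) v) && (y v \in before (perm_pos s) v))).
pose l2 (s : {perm V}) v := nat_of_bool (#|nb v :&: before (perm_pos s) v| < t).
have H (s : {perm V}) : #|V| * d.+1 <= g [set: V] + \sum_v (l1 s v + d.+1 * l2 s v).
  apply: (telescope_order (perm_pos_inj (s := s))) => v; apply: Hg.
  by rewrite inE ltnn.
(* If [v] does not come after both [x v] and [y v], it is among the first two of the three. *)
have L1 v : 3 * (\sum_s l1 s v) <= 2 * P.
  have [_ nexy nexv neyv] := Hv v.
  have vW : v \in [set v; x v; y v] by rewrite !inE eqxx.
  have := sum_early_leq 2 vW.
  have -> : #|[set v; x v; y v]| = 3.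
    by rewrite -setUA setUC -setUA cardsU1 cardsU1 cards1 !inE negb_or nexy nexv neyv.
  apply: leq_trans; rewrite leq_mul2l /=; apply: leq_sum => s _.
  rewrite /l1; case: ltnP => //; first by case: andP.
  case/card_gt1P => a [b [aW bW neab]]; move: aW bW; rewrite !inE.
  case/andP=> + lta /andP[+ ltb].
  case/orP=> [/orP[]|] /eqP ea; case/orP=> [/orP[]|] /eqP eb; move: neab lta ltb;
    by rewrite ea eb ?eqxx ?ltnn // => _ -> ->.
(* The symmetry bound needs a set containing [v]. Inserting [v] into [nb v] changes no count, since
   [v] is not before itself. *)
have L2 v : 6 * d.+1 * (\sum_s l2 s v) <= P.
  have [vN _ _ _] := Hv v; rewrite -(leq_pmul2l t_gt0).
  have := sum_early_leq t (setU11 v (nb v)); rewrite cardsU1 vN add1n.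
  apply: leq_trans; rewrite mulnA [t * _]mulnC; apply: leq_mul (Hdeg v) _.
  apply: leq_sum => s _; rewrite /l2 (_ : (v |: nb v) :&: _ = nb v :&: before (perm_pos s) v) //.
  by apply/setP => u; rewrite !inE; case: eqP => // ->; rewrite ltnn !andbF.
have : \sum_(s : {perm V}) #|V| * d.+1 <=
    \sum_(s : {perm V}) (g [set: V] + \sum_v (l1 s v + d.+1 * l2 s v)).
  by apply: leq_sum => s _; exact: H.
rewrite big_split /= !sum_nat_const exchange_big /= -/P => Hsum.
have : 6 * \sum_v \sum_s (l1 s v + d.+1 * l2 s v) <= #|V| * (5 * P).
  rewrite big_distrr -sum_nat_const; apply: leq_sum => v _.
  rewrite big_split -big_distrr /=; have := L1 v; have := L2 v.
  set X := \sum_s _; set Y := \sum_s _; nia.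
move: Hsum; set S := \sum_v _ => Hsum H6; rewrite -(leq_pmul2l P_gt0).
move: Hsum H6; clearbody S P; clear; move: (g _) #|V| => G n; nia.
Qed.

End RandomOrder.

Local Open Scope fset_scope.

(** * Matroid rank *)

Lemma fsubset_between (K : choiceType) (W A : {fset K}) (t : nat) :
  W `<=` A -> #|` W| <= t -> t <= #|` A| ->
  exists A', [/\ W `<=` A', A' `<=` A & #|` A'| = t].
Proof.
move=> sWA leWt; elim: t leWt => [|t IHt] leWt letA.
  by exists W; split=> //; lia.
have [eWt|neWt] := eqVneq #|` W| t.+1; first by exists W; split.
have [A' [sWA' sA'A cA']] := IHt ltac:(lia) ltac:(lia).
have [x xD] : exists x, x \in A `\` A'.
  apply/fset0Pn; rewrite -cardfs_gt0; have := cardfsID A' A.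
  rewrite (fsetIidPr sA'A) cA'; lia.
move: xD; rewrite inE => /andP[xA' xA]; exists (x |` A'); split.
- by rewrite (fsubset_trans sWA') // fsubsetUr.
- by rewrite fsubUset fsub1set xA.
- by rewrite cardfsU1 xA' cA'.
Qed.

Lemma exists_fsubset_card (K : choiceType) (A : {fset K}) (t : nat) :
  t <= #|` A| -> exists2 A', A' `<=` A & #|` A'| = t.
Proof.
move=> /(fsubset_between (fsub0set A)); rewrite cardfs0 => /(_ isT)[A' [_ sA' cA']].
by exists A'.
Qed.

Section Rank.
Variables (K : choiceType) (ind : {fset K} -> bool).
Hypothesis ind0 : ind fset0.
Hypothesis ind_sub : forall I J, ind I -> J `<=` I -> ind J.
Hypothesis ind_aug : forall I J, ind I -> ind J -> #|` I| < #|` J| ->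
  exists2 e, e \in J `\` I & ind (e |` I).

Definition mrank (F : {fset K}) : nat :=
  \max_(I <- fpowerset F | ind I) #|` I|.

Lemma leq_card_mrank I F : I `<=` F -> ind I -> #|` I| <= mrank F.
Proof.
by move=> sIF iI; rewrite /mrank (big_rem I) ?fpowersetE //= iI leq_maxl.
Qed.

Lemma mrank_leqP F m :
  reflect (forall I, I `<=` F -> ind I -> #|` I| <= m) (mrank F <= m).
Proof.
apply: (iffP idP) => [le I sI iI | H]; first exact: leq_trans (leq_card_mrank sI iI) le.
rewrite /mrank big_seq_cond; elim/big_ind: _ => // [x y|I].
  by rewrite geq_max => -> ->.
by rewrite fpowersetE => /andP[]; exact: H.
Qed.

Lemma mrank_extend I F : I `<=` F -> ind I ->
  exists B, [/\ I `<=` B, B `<=` F, ind B & #|` B| = mrank F].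
Proof.
move: {2}(mrank F - #|` I|) (leqnn (mrank F - #|` I|)) => n.
elim: n I => [|n IHn] I len sIF iI.
  exists I; split=> //; have := leq_card_mrank sIF iI; lia.
have [le|lt] := leqP (mrank F) #|` I|.
  by exists I; split=> //; apply/eqP; rewrite eqn_leq leq_card_mrank.
have [J sJF [iJ ltIJ]] : exists2 J, J `<=` F & ind J /\ #|` I| < #|` J|.
  apply: contrapT => nJ; move: lt; rewrite ltnNge => /negP; apply.
  apply/mrank_leqP => J sJ iJ; rewrite leqNgt; apply/negP => lt.
  by apply: nJ; exists J.
have [e eJI iE] := ind_aug iI iJ ltIJ.
move: eJI; rewrite inE => /andP[eI eJ].
have [||B [sB sBF iB cB]] := IHn (e |` I) _ _ iE.
- by rewrite cardfsU1 eI; lia.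
- by rewrite fsubUset sIF fsub1set (fsubsetP sJF).
- by exists B; split=> //; apply: fsubset_trans sB; exact: fsubsetUr.
Qed.

Lemma mrank_base F : exists B, [/\ B `<=` F, ind B & #|` B| = mrank F].
Proof. by have [B []] := mrank_extend (fsub0set F) ind0; exists B. Qed.

Lemma mrank_mono A B : A `<=` B -> mrank A <= mrank B.
Proof.
move=> sAB; apply/mrank_leqP => I sI; apply: leq_card_mrank.
exact: fsubset_trans sAB.
Qed.

(** A base [I] of the intersection extends to a base [J] of the union; the parts of [J] in [A] and
    in [B] are independent and overlap in at least [I]. *)
Lemma mrank_submod A B :
  mrank (A `|` B) + mrank (A `&` B) <= mrank A + mrank B.
Proof.
have [I [sI iI <-]] := mrank_base (A `&` B).
have sIU : I `<=` A `|` B.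
  by rewrite (fsubset_trans sI) // (fsubset_trans (fsubsetIl _ _)) ?fsubsetUl.
have [J [sIJ sJ iJ <-]] := mrank_extend sIU iI.
have leA : #|` J `&` A| <= mrank A.
  by apply: leq_card_mrank; [exact: fsubsetIr | apply: ind_sub iJ _; exact: fsubsetIl].
have leB : #|` J `&` B| <= mrank B.
  by apply: leq_card_mrank; [exact: fsubsetIr | apply: ind_sub iJ _; exact: fsubsetIl].
have := cardfsUI (J `&` A) (J `&` B).
rewrite -fsetIUr (fsetIidPl sJ) fsetIACA fsetIid.
have : #|` I| <= #|` J `&` (A `&` B)| by apply: fsubset_leq_card; rewrite fsubsetI sIJ.
lia.
Qed.

(** Submodularity as diminishing returns: [C] gains no more over [A'] than over [A]. The additive
    form avoids truncated subtraction. *)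
Lemma mrank_submodD A A' C : A `<=` A' ->
  mrank (A' `|` C) + mrank A <= mrank (A `|` C) + mrank A'.
Proof.
move=> sA; have := mrank_submod (A `|` C) A'.
have -> : A `|` C `|` A' = A' `|` C.
  by rewrite fsetUAC (fsetUidPr _ _ sA).
have : mrank A <= mrank ((A `|` C) `&` A').
  by apply: mrank_mono; rewrite fsubsetI sA fsubsetUl.
lia.
Qed.

(** Otherwise augmentation would enlarge a base of [A] by an element of [A] or [C], and neither
    raises the rank. *)
Lemma mrank_closure A C :
  (forall e, e \in C -> mrank (e |` A) = mrank A) -> mrank (A `|` C) = mrank A.
Proof.
move=> clC; apply/eqP; rewrite eqn_leq (mrank_mono (fsubsetUl _ _)) andbT leqNgt.
apply/negP; have [I [sI iI cI]] := mrank_base A.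
have [J [sJ iJ <-]] := mrank_base (A `|` C).
rewrite -cI => /(ind_aug iI iJ)[e]; rewrite inE => /andP[eI eJ] iE.
have sE : e |` I `<=` e |` A by exact: fsetUS.
have : mrank (e |` A) = mrank A.
  move/(fsubsetP sJ): eJ; rewrite inE => /orP[eA|]; last exact: clC.
  by congr mrank; apply/fsetUidPr; rewrite fsub1set.
by have := leq_card_mrank sE iE; rewrite cardfsU1 eI; lia.
Qed.
End Rank.

(** * Matroid union *)

Lemma simple_sub (G H : {fset edge}) : simple_graph G -> H `<=` G -> simple_graph H.
Proof. by move=> sG sH e /(fsubsetP sH)/sG. Qed.

Lemma simpleU (G H : {fset edge}) :
  simple_graph G -> simple_graph H -> simple_graph (G `|` H).
Proof. by move=> sG sH e; rewrite inE => /orP[/sG|/sH]. Qed.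

Section ColourClasses.
Variables (k : nat) (Ms : 'I_k -> graph_matroid_family).

Lemma card_colour_classes (K : choiceType) (I : {fset K}) (phi : K -> nat) :
  (forall e, e \in I -> phi e < k) ->
  #|` I| = \sum_(i < k) #|` [fset e in I | phi e == i]|.
Proof.
elim: k I => [|n IHn] I ltI.
  rewrite big_ord0; apply/eqP; rewrite cardfs_eq0; apply/eqP/fsetP => e.
  by rewrite [RHS]inE; apply/negP => /ltI.
rewrite big_ord_recr /= -(cardfsID [fset e in I | phi e == n] I) [LHS]addnC.
congr addn; last by congr (#|` _|); apply/fsetP => e; rewrite !inE /=; case: (e \in I).
rewrite (IHn (I `\` _)) => [|e]; last first.
  rewrite !inE /= => /andP[+ eI]; rewrite eI /= => ne.
  by have := ltI e eI; rewrite ltnS leq_eqVlt (negPf ne).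
apply: eq_bigr => i _; congr (#|` _|); apply/fsetP => e; rewrite !inE /=.
case: (e \in I) => //=; case: eqP => [->|_]; rewrite ?andbF ?andbT //.
by rewrite (gtn_eqF (ltn_ord i)).
Qed.

(** Overlapping sets [Is i] become disjoint when each element chooses one of them, as independence
    passes to subsets. Cardinality is then additive over the classes, which the augmentation
    needs. *)
Lemma union_ind_colour (G I : {fset edge}) : simple_graph G ->
  union_ind Ms G I <->
  exists phi : edge -> nat, (forall e, e \in I -> phi e < k) /\
    forall i : 'I_k, gmf_ind (Ms i) G [fset e in I | phi e == i].
Proof.
move=> sG; split=> [[Is [iIs ->]]|[phi [ltk iphi]]].
  (* The default [k] is not an index and does not occur on the union of the [Is i]. *)
  exists (fun e => if [pick i | e \in Is i] is Some i then nat_of_ord i else k).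
  split=> [e /bigfcupP[i _ ei]|i].
    by case: pickP => [j _|/(_ i)]; rewrite ?ei ?ltn_ord.
  have [_ _ Hsub _] := gmf_matroid (Ms i) sG; apply: Hsub (iIs i) _.
  apply/fsubsetP => e; rewrite !inE => /andP[_].
  case: pickP => [j ej /eqP/ord_inj <- //|_ /eqP ki].
  by have := ltn_ord i; rewrite -ki ltnn.
exists (fun i : 'I_k => [fset e in I | phi e == i]); split=> //; apply/fsetP => e.
apply/idP/bigfcupP => [eI|[i _]]; last by rewrite !inE => /andP[].
by exists (Ordinal (ltk e eI)); rewrite ?mem_enum // !inE /= eI eqxx.
Qed.

(* Among the colourings of [I], one that agrees with that of [J] most often admits the
   augmentation: if the augmenting element of some class already lay in [I], recolouring
   it would increase the agreement. *)
Lemma union_ind_aug (G I J : {fset edge}) : simple_graph G ->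
  union_ind Ms G I -> union_ind Ms G J -> #|` I| < #|` J| ->
  exists2 e, e \in J `\` I & union_ind Ms G (e |` I).
Proof.
move=> sG /(union_ind_colour _ sG)[phi Hphi] /(union_ind_colour _ sG)[psi [psik ipsi]] ltIJ.
pose agree f := #|` [fset e in I | (e \in J) && (f e == psi e)]|.
have [n] := ubnP (#|` I| - agree phi); elim: n phi Hphi => // n IHn phi [phik iphi] ltn.
have [i lti] : exists i : 'I_k,
    #|` [fset e in I | phi e == i]| < #|` [fset e in J | psi e == i]|.
  apply: contrapT => nex; move: ltIJ; rewrite ltnNge => /negP; apply.
  rewrite (card_colour_classes phik) (card_colour_classes psik).
  by apply: leq_sum => i _; rewrite leqNgt; apply/negP => lt; apply: nex; exists i.
have [_ _ _ Haug] := gmf_matroid (Ms i) sG.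
have [e] := Haug _ _ (iphi i) (ipsi i) lti.
rewrite !inE /= => /andP[eI /andP[eJ /eqP psie]] indE.
pose phi' x := if x == e then nat_of_ord i else phi x.
have col : (forall x, x \in e |` I -> phi' x < k) /\
    forall j : 'I_k, gmf_ind (Ms j) G [fset x in e |` I | phi' x == j].
  split=> [x|j]; first by rewrite !inE /phi'; case: eqP => //= _ /phik.
  have [->|neij] := eqVneq j i.
    suff -> : [fset x in e |` I | phi' x == i] = e |` [fset x in I | phi x == i] by [].
    by apply/fsetP => x; rewrite !inE /= /phi'; case: (x =P e) => [->|_] /=; rewrite ?eqxx.
  have [_ _ Hsub _] := gmf_matroid (Ms j) sG; apply: Hsub (iphi j) _.
  apply/fsubsetP => x; rewrite !inE /= /phi'; case: (x =P e) => //= _ /eqP/ord_inj eij.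
  by rewrite eij eqxx in neij.
have [eI'|eI'] := boolP (e \in I); last first.
  by exists e; [rewrite inE eI' eJ | apply/union_ind_colour => //; exists phi'].
have eIe : e |` I = I by apply/fsetUidPr; rewrite fsub1set.
have lta : agree phi < agree phi'.
  apply: fproper_ltn_card; rewrite fproperE; apply/andP; split.
    apply/fsubsetP => x; rewrite !inE /= /phi' => /andP[-> /andP[-> ]] /=.
    by case: (x =P e) => // ->; rewrite psie eqxx.
  apply/negP => /fsubsetP/(_ e); rewrite !inE /= /phi' eI' eJ eqxx psie eqxx /=.
  by move=> /(_ isT) phie; move: eI; rewrite eI' phie.
have : agree phi' <= #|` I|.
  by apply: fsubset_leq_card; apply/fsubsetP => x; rewrite !inE => /andP[].
by move=> ?; apply: (IHn phi'); [move: col; rewrite eIe | lia].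
Qed.

Lemma union_matroid (G : {fset edge}) :
  simple_graph G -> is_matroid G (union_ind Ms G).
Proof.
move=> sG; split; last by move=> I J; exact: union_ind_aug.
- move=> I [Is [iIs ->]]; apply/bigfcupsP => i _ _.
  by have [Hs _ _ _] := gmf_matroid (Ms i) sG; exact: Hs.
- apply/(union_ind_colour _ sG); exists (fun=> 0); split=> // i.
  have [_ H0 _ _] := gmf_matroid (Ms i) sG.
  by rewrite (_ : [fset _ in _ | _] = fset0) //; apply/fsetP => e; rewrite !inE.
- move=> I J [Is [iIs ->]] sJ; exists (fun i => Is i `&` J); split=> [i|].
    have [_ _ Hsub _] := gmf_matroid (Ms i) sG.
    by apply: Hsub (iIs i) _; exact: fsubsetIl.
  apply/fsetP => e; apply/idP/bigfcupP => [eJ|[i _]]; last by rewrite inE => /andP[].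
  have /bigfcupP[i ii ei] := fsubsetP sJ e eJ.
  by exists i; rewrite ?inE ?ei ?eJ.
Qed.

Lemma union_iso (G : {fset edge}) (f : nat -> nat) :
  simple_graph G -> {in verts G &, injective f} ->
  forall I, I `<=` G ->
    (union_ind Ms (map_edge f @` G) (map_edge f @` I) <-> union_ind Ms G I).
Proof.
move=> sG injf I sI; split=> [[Is [iIs eI]]|[Is [iIs ->]]].
  have sIs i : Is i `<=` map_edge f @` I.
    rewrite eI; apply/fsubsetP => e ei; apply/bigfcupP.
    by exists i; rewrite ?mem_enum.
  (* Each part is pulled back along [map_edge f], restricted to [I] so that it stays inside [G]. *)
  exists (fun i => [fset e in I | map_edge f e \in Is i]); split=> [i|].
    apply/(gmf_iso (Ms i) sG injf).
      by apply: fsubset_trans sI; apply/fsubsetP => e; rewrite !inE => /andP[].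
    rewrite (_ : _ @` [fset _ in _ | _] = Is i) //; apply/fsetP => e.
    apply/imfsetP/idP => /= [[x]|ei]; first by rewrite !inE /= => /andP[_ +] ->.
    have /imfsetP[x /= xI ex] := fsubsetP (sIs i) e ei.
    by exists x; rewrite // !inE /= xI -ex.
  apply/fsetP => e; apply/idP/bigfcupP => [eI'|[i _]]; last by rewrite !inE => /andP[].
  have : map_edge f e \in map_edge f @` I by apply: in_imfset.
  by rewrite eI => /bigfcupP[i ii ei]; exists i; rewrite // !inE /= eI'.
exists (fun i => map_edge f @` Is i); split=> [i|].
  apply/(gmf_iso (Ms i) sG injf) => //.
  by have [Hs _ _ _] := gmf_matroid (Ms i) sG; exact: Hs.
apply/fsetP => e; apply/imfsetP/bigfcupP => /= [[x /bigfcupP[i ii xi] ->]|[i ii]].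
  by exists i => //; apply: in_imfset.
by case/imfsetP => x /= xi ->; exists x => //; apply/bigfcupP; exists i.
Qed.

Lemma union_restr (G H : {fset edge}) : simple_graph G -> H `<=` G ->
  forall I, union_ind Ms H I <-> (union_ind Ms G I /\ I `<=` H).
Proof.
move=> sG sHG I; split=> [[Is [iIs ->]]|[[Is [iIs eI]] sIH]].
  have /all_and2[iG iH] i : gmf_ind (Ms i) G (Is i) /\ Is i `<=` H.
    exact/(gmf_restr (Ms i) sG sHG).
  by split; [exists Is | apply/bigfcupsP => i _ _].
exists Is; split=> // i; apply/(gmf_restr (Ms i) sG sHG); split=> //.
apply: fsubset_trans sIH; rewrite eI; apply/fsubsetP => e ei.
by apply/bigfcupP; exists i; rewrite ?mem_enum.
Qed.

Definition union_family : graph_matroid_family :=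
  GMF union_matroid union_iso union_restr.
End ColourClasses.

(** * Rank of a graph matroid family *)

Definition mkedge (u v : nat) : edge := (minn u v, maxn u v).

Lemma mkedgeC u v : mkedge u v = mkedge v u.
Proof. by rewrite /mkedge minnC maxnC. Qed.

Lemma mkedge_eq u v u' v' : mkedge u v = mkedge u' v' ->
  (u = u' /\ v = v') \/ (u = v' /\ v = u').
Proof. by case=> ? ?; lia. Qed.

Lemma mkedgeK (e : edge) : e.1 < e.2 -> e = mkedge e.1 e.2.
Proof. by case: e => a b /= lt; rewrite /mkedge; congr pair; lia. Qed.

Lemma map_mkedge f u v : map_edge f (mkedge u v) = mkedge (f u) (f v).
Proof.
rewrite /map_edge /mkedge /=.
have [[-> ->]|[-> ->]] : (minn u v = u /\ maxn u v = v) \/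
    (minn u v = v /\ maxn u v = u) by lia.
  by [].
by rewrite minnC maxnC.
Qed.

Lemma in_Kgraph V (e : edge) :
  (e \in Kgraph V) = [&& e.1 \in V, e.2 \in V & e.1 < e.2].
Proof.
by rewrite !inE /= [RHS]andbA.
Qed.

Lemma mkedge_Kgraph V u v : (mkedge u v \in Kgraph V) = [&& u \in V, v \in V & u != v].
Proof.
rewrite in_Kgraph /mkedge /=; case: (ltngtP u v) => [lt|lt|->].
- by rewrite lt.
- by rewrite lt; case: (u \in V); rewrite ?andbF.
- by rewrite ltnn.
Qed.

Lemma KgraphP V (e : edge) :
  reflect (exists u v, [/\ u \in V, v \in V, u != v & e = mkedge u v]) (e \in Kgraph V).
Proof.
apply: (iffP idP) => [|[u [v [uV vV ne ->]]]]; last by rewrite mkedge_Kgraph uV vV.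
rewrite in_Kgraph => /and3P[e1 e2 lt]; exists e.1, e.2; split=> //; first by rewrite ltn_eqF.
exact: mkedgeK.
Qed.

Lemma simple_Kgraph V : simple_graph (Kgraph V).
Proof. by move=> e; rewrite in_Kgraph => /and3P[]. Qed.
#[local] Hint Resolve simple_Kgraph : core.

Lemma Kgraph_mono V V' : V `<=` V' -> Kgraph V `<=` Kgraph V'.
Proof.
move=> /fsubsetP sV; apply/fsubsetP => e; rewrite !in_Kgraph => /and3P[/sV-> /sV-> ->].
by [].
Qed.

Definition biclique (A B : {fset nat}) : {fset edge} :=
  [fset mkedge a b | a in A, b in B].

Lemma bicliqueP A B e :
  reflect (exists a b, [/\ a \in A, b \in B & e = mkedge a b]) (e \in biclique A B).
Proof.
rewrite /biclique; apply: (iffP (imfset2P _ _ _ _ _)) => [[a aA [b bB ->]]|[a [b [aA bB ->]]]].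
  by exists a, b.
by exists a => //; exists b.
Qed.

Lemma mkedge_biclique A B a b : a \in A -> b \in B -> mkedge a b \in biclique A B.
Proof. by move=> aA bB; apply/bicliqueP; exists a, b. Qed.

Lemma biclique_mono A B A' B' : A `<=` A' -> B `<=` B' ->
  biclique A B `<=` biclique A' B'.
Proof.
move=> /fsubsetP sA /fsubsetP sB; apply/fsubsetP => e /bicliqueP[a [b [/sA aA /sB bB ->]]].
exact: mkedge_biclique.
Qed.

Lemma biclique_Kgraph A B V : A `<=` V -> B `<=` V -> [disjoint A & B] ->
  biclique A B `<=` Kgraph V.
Proof.
move=> /fsubsetP sA /fsubsetP sB dAB; apply/fsubsetP => e /bicliqueP[a [b [aA bB ->]]].
rewrite mkedge_Kgraph sA // sB //=; apply/eqP => eab.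
by move: (fdisjointP dAB a aA); rewrite eab bB.
Qed.

Lemma map_Kgraph f V : {in V &, injective f} ->
  map_edge f @` Kgraph V = Kgraph (f @` V).
Proof.
move=> injf; apply/fsetP => e; apply/imfsetP/KgraphP => /=.
  case=> x /KgraphP[u [v [uV vV ne ->]]] ->; exists (f u), (f v).
  rewrite map_mkedge; split=> //; try exact: in_imfset.
  by apply: contraNneq ne => /injf->.
case=> u [v [/imfsetP[x /= xV ->] /imfsetP[y /= yV ->] ne ->]].
exists (mkedge x y); last by rewrite map_mkedge.
by rewrite mkedge_Kgraph xV yV; apply: contraNneq ne => ->.
Qed.

Lemma map_biclique f A B :
  map_edge f @` biclique A B = biclique (f @` A) (f @` B).
Proof.
apply/fsetP => e; apply/imfsetP/bicliqueP => /=.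
  case=> x /bicliqueP[u [v [uV vV ->]]] ->; exists (f u), (f v).
  by rewrite map_mkedge; split=> //; exact: in_imfset.
case=> u [v [/imfsetP[x /= xV ->] /imfsetP[y /= yV ->] ->]].
by exists (mkedge x y); rewrite ?map_mkedge ?mkedge_biclique.
Qed.

Lemma Kgraph_U1 (V : {fset nat}) v : v \notin V ->
  Kgraph (v |` V) = Kgraph V `|` biclique [fset v] V.
Proof.
move=> vV; apply/fsetP => e; apply/KgraphP/idP.
  case=> x [y [/fset1UP[->|xV] /fset1UP[ey|yV] nexy ->]]; rewrite in_fsetU mkedge_Kgraph.
  - by move: nexy; rewrite ey eqxx.
  - by rewrite mkedge_biclique ?orbT ?inE.
  - by rewrite ey mkedgeC mkedge_biclique ?orbT ?inE.
  - by rewrite xV yV nexy.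
rewrite in_fsetU => /orP[/KgraphP[x [y [xV yV ne ->]]]|/bicliqueP[x [y []]]].
  by exists x, y; split; rewrite // !inE ?xV ?yV orbT.
rewrite inE => /eqP-> yV ->; exists v, y; split; rewrite // ?inE ?eqxx ?yV ?orbT //.
by apply: contraNneq vV => ->.
Qed.

Lemma biclique_U1l (A B : {fset nat}) a :
  biclique (a |` A) B = biclique A B `|` biclique [fset a] B.
Proof.
apply/fsetP => e; rewrite inE; apply/bicliqueP/orP.
  case=> x [y []]; rewrite !inE => /orP[/eqP->|xA] yB ->; [right|left];
    by rewrite mkedge_biclique // inE.
case=> /bicliqueP[x [y [xA yB ->]]]; exists x, y; split; rewrite // inE ?xA ?orbT //.
Qed.

Lemma biclique0 B : biclique fset0 B = fset0.
Proof. by apply/fsetP => e; rewrite [RHS]inE; apply/negP => /bicliqueP[x [y []]]; rewrite inE. Qed.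

Lemma exists_fset_bij (V V' : {fset nat}) : #|` V| = #|` V'| ->
  exists2 f : nat -> nat, {in V &, injective f} & f @` V = V'.
Proof.
move=> eV; pose f u := nth 0 V' (index u V).
have ltV u : u \in V -> index u V < size V' by rewrite -[size V']eV index_mem.
have injf : {in V &, injective f}.
  move=> u v uV vV /eqP; rewrite nth_uniq ?fset_uniq ?ltV // => /eqP ei.
  by rewrite -(nth_index 0 uV) ei nth_index.
exists f => //; apply/eqP; rewrite eqEfcard; apply/andP; split.
  by apply/fsubsetP => x /imfsetP[u /= uV ->]; apply/mem_nth/ltV.
by rewrite card_in_imfset ?eV.
Qed.

Lemma exists_fset_bij2 (A B A' B' : {fset nat}) :
  [disjoint A & B] -> [disjoint A' & B'] -> #|` A| = #|` A'| -> #|` B| = #|` B'| ->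
  exists f : nat -> nat, [/\ {in A `|` B &, injective f}, f @` A = A' & f @` B = B'].
Proof.
move=> dAB dAB' /exists_fset_bij[f injf fA] /exists_fset_bij[g injg gB].
pose h u := if u \in A then f u else g u.
have hA u : u \in A -> h u = f u by rewrite /h => ->.
have hB u : u \in B -> h u = g u.
  by rewrite /h => uB; case: ifP => // uA; move: (fdisjointP dAB u uA); rewrite uB.
have hAA' u : u \in A -> h u \in A' by move=> uA; rewrite hA // -fA in_imfset.
have hBB' u : u \in B -> h u \in B' by move=> uB; rewrite hB // -gB in_imfset.
exists h; split.
- move=> u v; rewrite !inE => /orP[uA|uB] /orP[vA|vB] ehuv.
  + by move: ehuv; rewrite !hA //; exact: injf.
  + by have := fdisjointP dAB' _ (hAA' u uA); rewrite ehuv hBB'.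
  + by have := fdisjointP dAB' _ (hAA' v vA); rewrite -ehuv hBB'.
  + by move: ehuv; rewrite !hB //; exact: injg.
- by rewrite -fA; apply: eq_in_imfset => // u uA; exact: hA.
- by rewrite -gB; apply: eq_in_imfset => // u uB; exact: hB.
Qed.

Lemma card_iota_fset m n : #|` [fset i in iota m n]| = n.
Proof. by rewrite card_fseq undup_id ?iota_uniq // size_iota. Qed.

Lemma verts_subP (G : {fset edge}) V :
  reflect (forall e, e \in G -> e.1 \in V /\ e.2 \in V) (verts G `<=` V).
Proof.
apply: (iffP idP) => [/fsubsetP sV e eG|H].
  by split; apply: sV; rewrite inE in_imfset ?orbT.
by apply/fsubsetP => x; rewrite inE => /orP[] /imfsetP[e /= /H[? ?] ->].
Qed.

Lemma verts_Kgraph V G : G `<=` Kgraph V -> verts G `<=` V.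
Proof.
by move=> sG; apply/verts_subP => e /(fsubsetP sG); rewrite in_Kgraph => /and3P[].
Qed.

Lemma sub_Kgraph_verts G : simple_graph G -> G `<=` Kgraph (verts G).
Proof.
move=> sG; apply/fsubsetP => e eG; have /verts_subP/(_ e eG)[e1 e2] := fsubset_refl (verts G).
by rewrite in_Kgraph e1 e2 sG.
Qed.

Section FamilyRank.
Variable M : graph_matroid_family.

(* Independence does not depend on the ambient graph, by [gmf_restr]. *)
Definition gind (I : {fset edge}) : bool := `[< simple_graph I /\ gmf_ind M I I >].

Lemma gindE G I : simple_graph G -> gmf_ind M G I <-> gind I /\ I `<=` G.
Proof.
move=> sG; split=> [iI|[/asboolP[sI iI] sIG]].
  have [Hs _ _ _] := gmf_matroid M sG; have sIG := Hs _ iI.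
  split=> //; apply/asboolP; split; first exact: simple_sub sG sIG.
  exact/(gmf_restr M sG sIG).
by have [] := (gmf_restr M sG sIG I).1 iI.
Qed.

Lemma gind_simple I : gind I -> simple_graph I.
Proof. by move/asboolP => []. Qed.

Lemma gind0 : gind fset0.
Proof.
have s0 : simple_graph fset0 by move=> e; rewrite inE.
by apply/asboolP; split=> //; have [] := gmf_matroid M s0.
Qed.

Lemma gind_sub I J : gind I -> J `<=` I -> gind J.
Proof.
move=> /asboolP[sI iI] sJI; have [_ _ Hsub _] := gmf_matroid M sI.
by have /(gindE _ sI)[] := Hsub _ _ iI sJI.
Qed.

Lemma gind_aug I J : gind I -> gind J -> #|` I| < #|` J| ->
  exists2 e, e \in J `\` I & gind (e |` I).
Proof.
move=> iI iJ lt; have sU := simpleU (gind_simple iI) (gind_simple iJ).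
have [_ _ _ Haug] := gmf_matroid M sU.
have [||e eJI /(gindE _ sU)[iE _]] := Haug I J _ _ lt; last by exists e.
  by apply/gindE => //; split; rewrite ?fsubsetUl.
by apply/gindE => //; split; rewrite ?fsubsetUr.
Qed.

Definition grank (F : {fset edge}) : nat := mrank gind F.

Lemma rank_isE G m : simple_graph G ->
  rank_is (gmf_ind M G) G m <-> m = grank G.
Proof.
move=> sG; split=> [[[I [sI /(gindE _ sG)[iI _] cI]] Hmax]|->].
  apply/eqP; rewrite eqn_leq -{1}cI leq_card_mrank //.
  by apply/mrank_leqP => J sJ iJ; apply: Hmax => //; apply/gindE.
split=> [|I sI /(gindE _ sG)[iI _]]; last exact: leq_card_mrank.
have [B [sB iB cB]] := mrank_base gind0 gind_aug G.
by exists B; split=> //; apply/gindE.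
Qed.

Lemma rigidE G : simple_graph G ->
  rigid (gmf_ind M) G <-> grank G = grank (Kgraph (verts G)).
Proof.
move=> sG; split=> [[m []]|e]; first by rewrite !rank_isE // => <- <-.
by exists (grank G); rewrite !rank_isE.
Qed.

Lemma grank_mono A B : A `<=` B -> grank A <= grank B.
Proof. exact: mrank_mono. Qed.

Lemma grank_submodD A A' C : A `<=` A' ->
  grank (A' `|` C) + grank A <= grank (A `|` C) + grank A'.
Proof. exact: (mrank_submodD gind0 gind_sub gind_aug). Qed.

Lemma grank_closure A C :
  (forall e, e \in C -> grank (e |` A) = grank A) -> grank (A `|` C) = grank A.
Proof. exact: (mrank_closure gind0 gind_aug). Qed.

Lemma grank_iso (V : {fset nat}) (f : nat -> nat) (F : {fset edge}) :
  {in V &, injective f} -> F `<=` Kgraph V ->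
  grank (map_edge f @` F) = grank F.
Proof.
move=> injf sF; have sV := verts_Kgraph sF.
have sF' := simple_sub (@simple_Kgraph V) sF.
have injF : {in verts F &, injective f}.
  by move=> u v /(fsubsetP sV) uV /(fsubsetP sV) vV; exact: injf.
have sfF : simple_graph (map_edge f @` F).
  apply: (@simple_sub (Kgraph (f @` V))); rewrite // -map_Kgraph //;
  by apply/subset_imfset/fsubsetP.
have iso I : I `<=` F -> gind (map_edge f @` I) <-> gind I.
  move=> sI; have sfI : map_edge f @` I `<=` map_edge f @` F by apply/subset_imfset/fsubsetP.
  have [H1 H2] := gmf_iso M sF' injF sI; split=> iI.
    by have /gindE[] := H1 ((gindE _ sfF).2 (conj iI sfI)).
  by have /gindE[] := H2 ((gindE _ sF').2 (conj iI sI)).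
have injm : {in F &, injective (map_edge f)}.
  move=> e e' /(fsubsetP sF)/KgraphP[u [v [uV vV _ ->]]].
  move=> /(fsubsetP sF)/KgraphP[u' [v' [uV' vV' _ ->]]].
  by rewrite !map_mkedge => /mkedge_eq[] [/injf-> // /injf-> //]; rewrite mkedgeC.
apply/eqP; rewrite eqn_leq; apply/andP; split.
  have [J [sJ iJ cJ]] := mrank_base gind0 gind_aug (map_edge f @` F).
  pose I := [fset e in F | map_edge f e \in J].
  have sI : I `<=` F by apply/fsubsetP => e; rewrite !inE => /andP[].
  have eJ : J = map_edge f @` I.
    apply/fsetP => e; apply/idP/imfsetP => /= [eJ|[x]].
      have /imfsetP[x /= xF ex] := fsubsetP sJ e eJ.
      by exists x; rewrite // !inE /= xF -ex.
    by rewrite !inE => /andP[_ +] ->.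
  rewrite /grank -cJ {1}eJ (leq_trans (leq_imfset_card _ _ _)) // leq_card_mrank //.
  by apply/iso; rewrite -?eJ.
have [I [sI iI cI]] := mrank_base gind0 gind_aug F.
have /card_in_imfsetP/eqP cfI : {in I &, injective (map_edge f)}.
  by move=> x y /(fsubsetP sI) xF /(fsubsetP sI) yF; exact: injm.
rewrite /grank -cI -cfI leq_card_mrank ?iso //; exact/subset_imfset/fsubsetP.
Qed.

Lemma grank_Kgraph_card V V' : #|` V| = #|` V'| ->
  grank (Kgraph V) = grank (Kgraph V').
Proof.
by move=> /exists_fset_bij[f injf <-]; rewrite -map_Kgraph // (grank_iso injf).
Qed.

(** Closure is monotone, by diminishing returns. *)
Lemma grank_closed_sub (F H : {fset edge}) e :
  F `<=` H -> grank (e |` F) = grank F -> grank (e |` H) = grank H.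
Proof.
move=> sFH ce; have := grank_submodD [fset e] sFH.
rewrite (fsetUC H) (fsetUC F) ce => le; apply/eqP; rewrite eqn_leq.
by rewrite (grank_mono (fsubsetUr _ _)) andbT; lia.
Qed.

(** By isomorphism invariance this is the rank of any clique on [m] vertices. *)
Definition kappa m := grank (Kgraph [fset i in iota 0 m]).

Lemma kappaE V : grank (Kgraph V) = kappa #|` V|.
Proof. by apply: grank_Kgraph_card; rewrite card_iota_fset. Qed.

(** Renaming [v] to [w] fixes [F] and [A], since neither vertex lies in [V]. Clones of a vertex thus
    gain the same rank. *)
Lemma grank_star_clone (V A : {fset nat}) (F : {fset edge}) v w :
  F `<=` Kgraph V -> v \notin V -> w \notin V -> A `<=` V ->
  grank (F `|` biclique [fset w] A) = grank (F `|` biclique [fset v] A).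
Proof.
move=> sF vV wV sA; pose f u := if u == v then w else u.
have fV u : u \in V -> f u = u.
  by rewrite /f; case: eqP => // -> ; rewrite (negPf vV).
have injf : {in v |` V &, injective f}.
  move=> x y; rewrite !inE /f => /orP[/eqP->|xV] /orP[/eqP->|yV]; rewrite ?eqxx //.
  - by case: eqP => [->//|_ e]; rewrite e yV in wV.
  - by case: eqP => [->//|_ e]; rewrite -e xV in wV.
  - by rewrite -/(f x) -/(f y) !fV.
rewrite -[RHS](grank_iso injf); last first.
  by rewrite Kgraph_U1 // fsetUSS // biclique_mono.
have -> : map_edge f @` (F `|` biclique [fset v] A) =
    map_edge f @` F `|` biclique [fset w] (f @` A).
  by rewrite imfsetU map_biclique imfset_fset1 /f eqxx.
congr (grank (_ `|` biclique _ _)).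
  rewrite -[LHS]imfset_id; apply: eq_in_imfset => // e eF.
  have /KgraphP[x [y [xV yV _ ->]]] := fsubsetP sF e eF.
  by rewrite map_mkedge !fV.
rewrite -[LHS]imfset_id; apply: eq_in_imfset => // x xA; rewrite fV //.
exact: (fsubsetP sA).
Qed.

(** [H] is the closure of [G] inside the clique; for a closed graph, rigidity means completeness. *)
Lemma exists_closed (V : {fset nat}) (G : {fset edge}) : G `<=` Kgraph V ->
  exists H, [/\ G `<=` H, H `<=` Kgraph V, grank H = grank G &
    forall e, e \in Kgraph V -> e \notin H -> grank H < grank (e |` H)].
Proof.
move=> sG; pose H := [fset e in Kgraph V | grank (e |` G) == grank G].
have inH e : (e \in H) = (e \in Kgraph V) && (grank (e |` G) == grank G).
  by rewrite in_fset /= inE.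
have sGH : G `<=` H.
  apply/fsubsetP => e eG; rewrite inH (fsubsetP sG) //=.
  by rewrite (fsetUidPr [fset e] G _) // fsub1set.
have rH : grank H = grank G.
  rewrite -(fsetUidPr _ _ sGH); apply: grank_closure => e.
  by rewrite inH => /andP[_ /eqP].
exists H; split=> //; first by apply/fsubsetP => e; rewrite inH => /andP[].
move=> e eK; rewrite inH eK /= => ne; rewrite rH.
apply: (@leq_trans (grank (e |` G))); last by rewrite grank_mono // fsetUS.
by rewrite ltn_neqAle eq_sym ne grank_mono // fsubsetUr.
Qed.

End FamilyRank.

(** * Families with a rigid biclique *)

Section BicliqueRigid.
Variables (M : graph_matroid_family) (T : nat) (A0 B0 : {fset nat}).
Hypotheses (T_gt1 : 1 < T) (disAB0 : [disjoint A0 & B0]).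
Hypotheses (cardA0 : #|` A0| = T) (cardB0 : #|` B0| = T).
Local Notation r := (grank M).
Local Notation kappa := (kappa M).
Hypothesis rigid0 : r (biclique A0 B0) = r (Kgraph (A0 `|` B0)).

Lemma biclique_rigid (A B : {fset nat}) : [disjoint A & B] -> #|` A| = T -> #|` B| = T ->
  r (biclique A B) = r (Kgraph (A `|` B)).
Proof.
move=> dAB cA cB; rewrite -cardA0 in cA; rewrite -cardB0 in cB.
have [f [injf <- <-]] := exists_fset_bij2 disAB0 dAB (esym cA) (esym cB).
have sAB := biclique_Kgraph (fsubsetUl A0 B0) (fsubsetUr A0 B0) disAB0.
by rewrite -map_biclique (grank_iso _ injf) // rigid0 -imfsetU -map_Kgraph // (grank_iso _ injf).
Qed.

(** Choose parts of [A] and [B] of size [T] that still contain [u] and [v]; the rigid biclique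
    between these parts has the edge in its closure. *)
Lemma biclique_closed (A B : {fset nat}) (F : {fset edge}) u v :
  [disjoint A & B] -> T <= #|` A| -> T <= #|` B| -> biclique A B `<=` F ->
  u \in A `|` B -> v \in A `|` B -> u != v ->
  r (mkedge u v |` F) = r F.
Proof.
move=> dAB leA leB sF uU vU neuv.
(* Both [u] and [v] may lie on one side, so a part of size [T] needs room for two. *)
have pick (C : {fset nat}) : T <= #|` C| ->
    exists C', [/\ C `&` [fset u; v] `<=` C', C' `<=` C & #|` C'| = T].
  move=> leC; apply: fsubset_between => //; first exact: fsubsetIl.
  apply: leq_trans T_gt1; apply: leq_trans (fsubset_leq_card (fsubsetIr _ _)) _.
  by rewrite cardfs2 neuv.
have [A' [uvA sA cA]] := pick A leA; have [B' [uvB sB cB]] := pick B leB.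
have dAB' : [disjoint A' & B'] by exact: fdisjointWl sA (fdisjointWr sB dAB).
have inU w : w \in A `|` B -> w \in [fset u; v] -> w \in A' `|` B'.
  rewrite !inE => /orP[wA|wB] wuv; apply/orP; [left|right].
    by apply: (fsubsetP uvA); rewrite !inE wA wuv.
  by apply: (fsubsetP uvB); rewrite !inE wB wuv.
apply: (@grank_closed_sub _ (biclique A' B')).
  exact: fsubset_trans (biclique_mono sA sB) sF.
apply/eqP; rewrite eqn_leq (grank_mono _ (fsubsetUr _ _)) andbT.
rewrite [X in _ <= X]biclique_rigid // grank_mono // fsubUset fsub1set.
rewrite mkedge_Kgraph neuv (inU u) ?(inU v) ?in_fset2 ?eqxx ?orbT //=.
by rewrite biclique_Kgraph ?fsubsetUl ?fsubsetUr.
Qed.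

(** Take [T] vertices [A'] of [A]. The biclique between [A'] and the remaining vertices, [v]
    included, is present, so every missing edge at [v] lies in the closure. *)
Lemma grank_Kgraph_star (V A : {fset nat}) v : v \notin V -> A `<=` V ->
  T <= #|` A| -> T.*2 <= #|` V| ->
  r (Kgraph V `|` biclique [fset v] A) = kappa #|` V|.+1.
Proof.
move=> vV sAV leA leV.
have -> : #|` V|.+1 = #|` v |` V| by rewrite cardfsU1 vV.
have [A' sA' cA'] := exists_fsubset_card leA.
rewrite -kappaE Kgraph_U1 //; set F := Kgraph V `|` biclique [fset v] A.
have sF : F `<=` Kgraph V `|` biclique [fset v] V.
  by rewrite fsetUS // biclique_mono.
have -> : Kgraph V `|` biclique [fset v] V = F `|` biclique [fset v] V.
  apply/eqP; rewrite eqEfsubset [X in _ && X]fsubUset sF fsubsetUr !andbT.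
  by rewrite fsubUset fsubsetUr andbT /F -fsetUA fsubsetUl.
rewrite grank_closure // => e /bicliqueP[x [u []]]; rewrite inE => /eqP-> uV ->.
have vA' : v \notin A' by apply: contra vV => /(fsubsetP sA')/(fsubsetP sAV).
have sA'V := fsubset_trans sA' sAV.
apply: (@biclique_closed A' (v |` (V `\` A'))).
- apply/fdisjointP => z zA'; rewrite !inE zA' /= orbF.
  by apply: contraNneq vA' => <-.
- by rewrite cA'.
- rewrite cardfsU1 !inE (negPf vV) andbF /= cardfsDS // cA'; lia.
- apply/fsubsetP => e' /bicliqueP[x' [y [xA']]].
  move=> /fset1UP[->|/fsetDP[yV yA']] ->; rewrite /F in_fsetU mkedge_Kgraph.
    by rewrite mkedgeC (mkedge_biclique (A := [fset v])) ?inE ?orbT // (fsubsetP sA').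
  rewrite (fsubsetP sA'V) // yV /=.
  by case: eqP => // exy; rewrite exy (negPf yA') in xA'.
- by rewrite !inE eqxx orbT.
- by rewrite !inE uV andbT; case: (u \in A'); rewrite ?orbT.
- by apply: contraNneq vV => ->.
Qed.

(** A new vertex with [T] edges gains a full increment of [kappa] over a clique on [m] vertices and
    over one on [m + 1]; the second gain is no larger, by diminishing returns. *)
Lemma kappa_concave m : T.*2 <= m -> kappa m.+2 + kappa m <= kappa m.+1 + kappa m.+1.
Proof.
move=> lem; pose V := [fset i in iota 0 m].
have cV : #|` V| = m by exact: card_iota_fset.
have inV x : (x \in V) = (x < m) by rewrite inE /= mem_iota.
have mV : m \notin V by rewrite inV ltnn.
have m1V : m.+1 \notin m |` V by rewrite in_fset1U inV; lia.
have m1V' : m.+1 \notin V by rewrite inV; lia.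
have [|A sA cA] := @exists_fsubset_card _ V T; first by rewrite cV; lia.
have cmV : #|` m |` V| = m.+1 by rewrite cardfsU1 mV cV.
have := grank_submodD M (biclique [fset m.+1] A) (Kgraph_mono (fsubsetUr [fset m] V)).
rewrite !grank_Kgraph_star ?kappaE ?cmV ?cV ?cA //.
  by rewrite (fsubset_trans sA) ?fsubsetUr.
lia.
Qed.

(** By concavity the increments do not grow from [T.*2] on; [d] is their least value, attained at
    [m1] and kept afterwards. *)
Lemma exists_dimension : exists d m1,
  (forall m, T.*2 <= m -> kappa m + d <= kappa m.+1) /\
  (forall n, m1 <= n -> kappa n <= kappa m1 + d * n).
Proof.
pose P d := `[< exists2 m, T.*2 <= m & kappa m.+1 - kappa m = d >].
have exP : exists d, P d by exists (kappa T.*2.+1 - kappa T.*2); apply/asboolP; exists T.*2.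
have leK m : kappa m <= kappa m.+1.
  apply/grank_mono/Kgraph_mono/fsubsetP => x; rewrite !inE /= !mem_iota; lia.
case: (ex_minnP exP) => d /asboolP[m1 lem1 ed] dmin; exists d, m1; split=> [m lem|n].
  have := dmin _ (asboolT (ex_intro2 _ _ m lem erefl)); have := leK m; lia.
elim: n => [|n IHn]; first by rewrite leqn0 => /eqP->; rewrite leq_addr.
rewrite leq_eqVlt => /orP[/eqP->|lt]; first by rewrite leq_addr.
have step : forall j, kappa (m1 + j).+1 <= kappa (m1 + j) + d.
  elim=> [|j IHj]; first by rewrite addn0; have := leK m1; lia.
  have := @kappa_concave (m1 + j) ltac:(lia); rewrite addnS; lia.
have := step (n - m1); rewrite subnKC //; have := IHn lt; lia.
Qed.

Variable d : nat.
Hypothesis dP : forall m, T.*2 <= m -> kappa m + d <= kappa m.+1.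

(** Over the full clique this star gains an increment of [kappa], hence at least [d], and over the
    smaller [F] it gains no less. *)
Lemma grank_star (V A : {fset nat}) (F : {fset edge}) v : F `<=` Kgraph V -> v \notin V ->
  A `<=` V -> T <= #|` A| -> T.*2 <= #|` V| ->
  r F + d <= r (F `|` biclique [fset v] A).
Proof.
move=> sF vV sA leA leV; have := grank_submodD M (biclique [fset v] A) sF.
rewrite grank_Kgraph_star // kappaE; have := dP leV; lia.
Qed.

(* If [v] gained only [d], so would each of [T] clones of [v]; but these make the
   attachment set complete, hence raise the rank by [T * d + 1]. *)
Lemma grank_star_nonadjacent (V A : {fset nat}) (F : {fset edge}) v x y :
  F `<=` Kgraph V -> v \notin V -> A `<=` V -> T <= #|` A| -> T.*2 <= #|` V| ->
  x \in A -> y \in A -> x != y -> r F < r (mkedge x y |` F) ->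
  r F + d < r (F `|` biclique [fset v] A).
Proof.
move=> sF vV sA leA leV xA yA nexy ltF; rewrite ltnNge; apply/negP => leFv.
(* All numbers from [b] on lie outside [V] and can name the clones of [v]. *)
pose b := (\sum_(i <- V) i).+1.
have bV i : b <= i -> i \notin V.
  move=> lebi; apply/negP => iV; move: lebi; rewrite /b (big_rem i) //=; lia.
pose W n := [fset i in iota b n].
have WS n : W n.+1 = (b + n)%N |` W n.
  by apply/fsetP => i; rewrite !inE /= !mem_iota; lia.
have WV n : [disjoint W n & V].
  by apply/fdisjointP => i; rewrite !inE /= mem_iota => /andP[/bV].
pose F' := mkedge x y |` F.
have sF' : F' `<=` Kgraph V.
  by rewrite fsubUset sF fsub1set mkedge_Kgraph !(fsubsetP sA) // nexy.
(* A clone gains over [F] and the earlier clones at most what it gains over [F], hence at most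
   [d]. *)
have up n : r (F `|` biclique (W n) A) <= r F + n * d.
  elim: n => [|n IHn].
    by rewrite (_ : W 0 = fset0) ?biclique0 ?fsetU0 ?leq_addr //; apply/fsetP => i; rewrite !inE.
  rewrite WS biclique_U1l fsetUA.
  have := grank_submodD M (biclique [fset (b + n)%N] A) (fsubsetUl F (biclique (W n) A)).
  rewrite (grank_star_clone M sF vV (bV _ (leq_addr n b)) sA); lia.
(* Each clone gains at least [d], by [grank_star] on [V] enlarged by the earlier clones. *)
have lo n : r F' + n * d <= r (F' `|` biclique (W n) A).
  elim: n => [|n IHn]; first by rewrite addn0 grank_mono ?fsubsetUl.
  rewrite WS biclique_U1l fsetUA.
  have := @grank_star (W n `|` V) A (F' `|` biclique (W n) A) (b + n)%N.
  have -> : F' `|` biclique (W n) A `<=` Kgraph (W n `|` V).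
    rewrite fsubUset (fsubset_trans sF') ?Kgraph_mono ?fsubsetUr //.
    rewrite biclique_Kgraph ?fsubsetUl //; first by rewrite (fsubset_trans sA) ?fsubsetUr.
    exact: fdisjointWr sA (WV n).
  have -> : (b + n)%N \notin W n `|` V.
    by rewrite inE negb_or bV ?leq_addr // andbT !inE /= mem_iota; lia.
  rewrite (fsubset_trans sA) ?fsubsetUr // leA.
  rewrite (leq_trans leV) ?fsubset_leq_card ?fsubsetUr // => /(_ isT isT isT isT isT).
  by move: IHn; lia.
(* With [T] clones, the biclique between [W T] and [A] spans the edge from [x] to [y], so [F] and
   [F'] have equal rank once the clones are attached; [up] and [lo] then contradict [r F < r F']. *)
have := biclique_closed (A := W T) (B := A) (F := F `|` biclique (W T) A) (u := x) (v := y).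
rewrite (fdisjointWr sA (WV T)) card_iota_fset leqnn leA fsubsetUr !inE xA yA !orbT nexy.
move=> /(_ isT isT isT isT isT isT isT).
rewrite fsetUA; have := up T; have := lo T; rewrite -/F'; move: ltF; rewrite -/F'; lia.
Qed.

End BicliqueRigid.

(** * Connectivity through separators *)

Definition separators_geq (N : nat) (V : {fset nat}) (G : {fset edge}) : Prop :=
  forall A B : {fset nat}, A `<=` V -> B `<=` V -> [disjoint A & B] ->
    A != fset0 -> B != fset0 ->
    (forall a b, a \in A -> b \in B -> mkedge a b \notin G) ->
    N <= #|` V `\` (A `|` B)|.

Lemma separators_geq_mono N V G H : G `<=` H ->
  separators_geq N V G -> separators_geq N V H.
Proof.
move=> sGH sepG A B sA sB dAB A0 B0 noE; apply: sepG => // a b aA bB.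
by apply: contra (noE a b aA bB); exact: fsubsetP.
Qed.

(** Once all vertices outside [A] and [B] are deleted, a path starting in [A] cannot leave [A]. *)
Lemma c_connected_separators N G : simple_graph G -> c_connected N G ->
  separators_geq N (verts G) G.
Proof.
move=> sG [_ conn] A B sA sB dAB /fset0Pn[u uA] /fset0Pn[v vB] noE.
rewrite leqNgt; apply/negP => ltN; set X := verts G `\` (A `|` B) in ltN.
have [||p [pathp lastp]] := conn X (fsubsetDl _ _) ltN u v.
- by rewrite in_fsetD in_fsetD in_fsetU uA (fsubsetP sA).
- by rewrite in_fsetD in_fsetD in_fsetU vB orbT (fsubsetP sB).
suff vA : v \in A by have := fdisjointP dAB v vA; rewrite vB.
rewrite -lastp; elim: p u uA pathp {lastp} => //= w p IHp u uA /andP[/andP[uw wX]].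
apply: IHp.
have Guw : mkedge u w \in G.
  case/orP: uw => uw; first by rewrite -(mkedgeK (sG _ uw)).
  by rewrite mkedgeC -(mkedgeK (sG _ uw)).
have wV : w \in verts G.
  have /verts_subP H := fsubset_refl (verts G).
  by case/orP: uw => /H[].
move: wX; rewrite in_fsetD in_fsetU wV andbT negbK => /orP[//|wB].
by have := noE u w uA wB; rewrite Guw.
Qed.

(** The vertex [v] has neighbours in at most one of two unlinked sets, because its neighbours form a
    clique; it can join that side without changing the separator. Complete graphs satisfy the
    condition vacuously, so the deletion may go on down to few vertices. *)
Lemma separators_geq_simplicial N V (H : {fset edge}) v : v \in V ->
  (forall x y, x \in V -> y \in V -> x != y -> mkedge v x \in H -> mkedge v y \in H ->
     mkedge x y \in H) ->
  separators_geq N V H ->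
  separators_geq N (V `\ v) (H `&` Kgraph (V `\ v)).
Proof.
move=> vV simpl sep A B sA sB dAB A0 B0 noE.
have sub C : C `<=` V `\ v -> v \notin C /\ C `<=` V.
  by rewrite fsubsetD1 => /andP[].
have [vA sAV] := sub A sA; have [vB sBV] := sub B sB.
have neAB a b : a \in A -> b \in B -> a != b.
  by move=> aA bB; apply: contraTneq bB => <-; exact: (fdisjointP dAB).
have noE' a b : a \in A -> b \in B -> mkedge a b \notin H.
  move=> aA bB; have := noE a b aA bB.
  by rewrite in_fsetI mkedge_Kgraph (fsubsetP sA) // (fsubsetP sB) // neAB //= andbT.
have [[b bB vb]|nvB] := pselect (exists2 b, b \in B & mkedge v b \in H).
  have -> : (V `\ v) `\` (A `|` B) = V `\` (A `|` (v |` B)).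
    apply/fsetP => x; rewrite !inE.
    by do ![case: (_ \in _) | case: eqP => _] => //=; rewrite ?andbF.
  apply: sep => //.
  - by rewrite fsubUset fsub1set vV.
  - by rewrite fdisjointXU fdisjointX1 vA.
  - by apply/fset0Pn; exists v; rewrite !inE eqxx.
  move=> a w aA /fset1UP[->|]; last exact: noE'.
  apply/negP; rewrite mkedgeC => va; have := noE' a b aA bB; rewrite simpl //.
  - exact: (fsubsetP sAV).
  - exact: (fsubsetP sBV).
  - exact: neAB.
have -> : (V `\ v) `\` (A `|` B) = V `\` ((v |` A) `|` B).
  by apply/fsetP => x; rewrite !inE; do ![case: (_ \in _) | case: eqP => _] => //=; rewrite ?andbF.
apply: sep => //.
- by rewrite fsubUset fsub1set vV.
- by rewrite fdisjointU1X vB.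
- by apply/fset0Pn; exists v; rewrite !inE eqxx.
move=> w b /fset1UP[->|wA] bB; last exact: noE'.
by apply/negP => vb; apply: nvB; exists b.
Qed.

Definition nbhd (H : {fset edge}) (V : {fset nat}) (v : nat) : {fset nat} :=
  [fset u in V | mkedge v u \in H].

Lemma in_nbhd H V v u : (u \in nbhd H V v) = (u \in V) && (mkedge v u \in H).
Proof. by rewrite !inE. Qed.

(** Two non-adjacent vertices are separated by all the others. *)
Lemma separators_geq_card N V H x y : separators_geq N V H ->
  x \in V -> y \in V -> x != y -> mkedge x y \notin H -> N.+2 <= #|` V|.
Proof.
move=> sep xV yV ne xyH; have := sep [fset x] [fset y]; rewrite !fsub1set xV yV.
rewrite fdisjoint1X !inE ne -!cardfs_gt0 !cardfs1 => /(_ isT isT isT isT isT) H0.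
have := H0 (fun a b => _); rewrite cardfsDS; last by rewrite fsubUset !fsub1set xV.
rewrite cardfs2 ne => le; have : 2 <= #|` V|.
  by have := @fsubset_leq_card _ [fset x; y] V; rewrite fsubUset !fsub1set xV yV cardfs2 ne => ->.
have : N <= #|` V| - 2.
  by apply: le => a b; rewrite !inE => /eqP-> /eqP->.
lia.
Qed.

(** The neighbourhood separates [v] from its non-neighbours; if there are none, it consists of all
    other vertices. *)
Lemma separators_geq_degree N V H v : H `<=` Kgraph V -> separators_geq N V H ->
  v \in V -> N < #|` V| -> N <= #|` nbhd H V v|.
Proof.
move=> sH sep vV ltNV.
have vn : v \notin nbhd H V v.
  rewrite in_nbhd vV /=; apply/negP => /(fsubsetP sH); rewrite mkedge_Kgraph eqxx.
  by rewrite !andbF.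
have [B0|B0] := eqVneq (V `\` (v |` nbhd H V v)) fset0.
  move/eqP: B0; rewrite fsetD_eq0 => /fsubset_leq_card; rewrite cardfsU1 vn; lia.
have := sep [fset v] (V `\` (v |` nbhd H V v)).
have -> : V `\` ([fset v] `|` V `\` (v |` nbhd H V v)) = nbhd H V v.
  apply/fsetP => u; rewrite in_fsetD in_fsetU in_fset1 in_fsetD in_fset1U in_nbhd.
  case: eqP => [->|_] /=; last by case: (u \in V); case: (_ \in H).
  by move: vn; rewrite in_nbhd => /negPf->.
apply=> //; rewrite ?fsub1set ?fsubsetDl //.
- by rewrite fdisjoint1X in_fsetD in_fset1U eqxx.
- by apply/fset0Pn; exists v; rewrite inE.
move=> a b; rewrite in_fset1 => /eqP-> /fsetDP[bV]; rewrite in_fset1U in_nbhd bV /=.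
by rewrite negb_or => /andP[].
Qed.

(** * Rigidity of highly connected graphs *)

Section Main.
Variables (M : graph_matroid_family) (T : nat) (A0 B0 : {fset nat}).
Hypotheses (T_gt1 : 1 < T) (disAB0 : [disjoint A0 & B0]).
Hypotheses (cardA0 : #|` A0| = T) (cardB0 : #|` B0| = T).
Local Notation r := (grank M).
Hypothesis rigid0 : r (biclique A0 B0) = r (Kgraph (A0 `|` B0)).
Local Notation kappa := (kappa M).

Variable d : nat.
Hypothesis dP : forall m, T.*2 <= m -> kappa m + d <= kappa m.+1.

(** The random order bound is applied to the rank of induced subgraphs of [H], with [t] equal to
    [T.*2]; this is the origin of [12 * T * d.+1]. *)
Lemma closed_rank_bound (N : nat) (V : {fset nat}) (H : {fset edge}) : H `<=` Kgraph V ->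
  (forall e, e \in Kgraph V -> e \notin H -> r H < r (e |` H)) ->
  12 * T * d.+1 <= N -> (forall v, v \in V -> N <= #|` nbhd H V v|) ->
  (forall v, v \in V -> exists x y, [/\ x \in nbhd H V v, y \in nbhd H V v,
     x != y & mkedge x y \notin H]) ->
  (6 * d + 1) * #|` V| <= 6 * r H.
Proof.
move=> sH clH leN deg nonadj.
(* The random orders live on the finite type of elements of [V]; [U] translates its subsets into
   sets of naturals. *)
pose U (S : {set V}) : {fset nat} := [fset val u | u in S].
have inU (S : {set V}) u : (val u \in U S) = (u \in S).
  apply/imfsetP/idP => [[w /= wS /val_inj-> //]|uS]; by exists u.
have UP (S : {set V}) w : w \in U S -> exists2 u, u \in S & w = val u.
  by case/imfsetP => u /= uS ->; exists u.
have cU (S : {set V}) : #|` U S| = #|S| by rewrite card_imfset /= ?cardE //; exact: val_inj.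
have UV S : U S `<=` V by apply/fsubsetP => w /UP[u _ ->]; exact: valP.
have Umono (S S' : {set V}) : S \subset S' -> U S `<=` U S'.
  by move=> /subsetP sS; apply/fsubsetP => w /UP[u uS ->]; rewrite inU sS.
pose g S := r (H `&` Kgraph (U S)).
have gmono (S S' : {set V}) : S \subset S' -> g S <= g S'.
  by move=> sS; rewrite grank_mono // fsetIS // Kgraph_mono // Umono.
pose nb (v : V) := [set u : V | mkedge (val v) (val u) \in H].
have nbE v : U (nb v) = nbhd H V (val v).
  apply/fsetP => w; rewrite in_nbhd; apply/idP/andP => [/UP[u + ->]|[wV vw]].
    by rewrite inE; split=> //; exact: valP.
  by rewrite -[w]/(val [` wV]) inU inE.
have irr v : mkedge v v \notin H.
  by apply/negP => /(fsubsetP sH); rewrite mkedge_Kgraph eqxx !andbF.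
have /choice[xy Hxy] : forall v : V, exists xy : V * V,
    [/\ xy.1 \in nb v, xy.2 \in nb v, xy.1 != xy.2 & mkedge (val xy.1) (val xy.2) \notin H].
  move=> v; have [x [y []]] := nonadj _ (valP v); rewrite -nbE.
  by case/UP => x' x'nb -> /UP[y' y'nb ->] ne nH; exists (x', y'); split=> //=.
have -> : #|` V| = #|{: V}| by rewrite cardfE.
have -> : r H = g [set: V].
  congr r; apply/esym/fsetIidPl.
  suff -> : U [set: V] = V by [].
  apply/fsetP => w; apply/idP/idP => [/(fsubsetP (UV _))//|wV].
  by rewrite -[w]/(val [` wV]) inU inE.
apply: (@random_order_bound _ g d T.*2 nb (fun v => (xy v).1) (fun v => (xy v).2)).
- by rewrite double_gt0; lia.
- move=> v; have [xnb ynb ne _] := Hxy v; split=> //.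
  + by rewrite inE irr.
  + by apply: contraTneq xnb => ->; rewrite inE irr.
  + by apply: contraTneq ynb => ->; rewrite inE irr.
- have le1 : 6 * d.+1 * T.*2 <= N by rewrite -muln2; lia.
  by move=> v; rewrite -cU nbE; exact: leq_trans le1 (leqW (deg _ (valP v))).
(* With few earlier neighbours the penalty covers all of [d.+1], and monotonicity suffices. *)
move=> v S vS; have [lt|le] := ltnP; first by have := gmono S (v |: S) (subsetUr _ _); lia.
rewrite muln0 addn0; set F := H `&` Kgraph (U S); pose A := U (nb v :&: S).
have sF : F `<=` Kgraph (U S) by exact: fsubsetIr.
have vU : val v \notin U S by rewrite inU.
have sA : A `<=` U S by rewrite Umono // subsetIr.
have leA : T <= #|` A| by rewrite cU; apply: leq_trans le; rewrite -addnn leq_addr.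
have leU : T.*2 <= #|` U S| by apply: leq_trans (fsubset_leq_card sA); rewrite cU.
have leg : r (F `|` biclique [fset val v] A) <= g (v |: S).
  rewrite grank_mono // fsubUset fsetIS ?Kgraph_mono ?Umono ?subsetUr //=.
  apply/fsubsetP => e /bicliqueP[a [b []]]; rewrite in_fset1 => /eqP-> /UP[u uS ->] ->.
  move: uS; rewrite !in_setI in_set => /andP[vu uS]; rewrite in_fsetI vu mkedge_Kgraph.
  by rewrite !inU !inE eqxx uS orbT /=; apply: contraNneq vS => /val_inj->.
apply: leq_trans (leq_add leg (leqnn _)) => //.
have [/andP[xS yS]|_] := boolP (_ && _); last first.
  by rewrite addn1 addnS ltnS; exact: (grank_star T_gt1 disAB0 cardA0 cardB0 rigid0 dP sF vU sA).
have [xnb ynb ne nH] := Hxy v.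
rewrite addn0 addnS.
apply: (grank_star_nonadjacent T_gt1 disAB0 cardA0 cardB0 rigid0 dP (V := U S) (x := val (xy v).1)
  (y := val (xy v).2)) => //.
- by rewrite /A inU in_setI xnb.
- by rewrite /A inU in_setI ynb.
(* The edge between the two neighbours is missing from the closed [H], so the subgraph [F] does not
   span it either. *)
have lt : r H < r (mkedge (val (xy v).1) (val (xy v).2) |` H).
  by apply: clH => //; rewrite mkedge_Kgraph; apply/and3P; split=> //; exact: fsvalP.
rewrite ltn_neqAle grank_mono ?fsubsetUr // andbT; apply/eqP => eF.
by move: lt; rewrite (grank_closed_sub (fsubsetIl H (Kgraph (U S))) (esym eF)) ltnn.
Qed.

(** The three summands below [N] serve the final count, the use of [km1] at the size of [V], and the
    degree condition of [closed_rank_bound]. *)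
Lemma separators_geq_rigid N m1 :
  (forall n, m1 <= n -> kappa n <= kappa m1 + d * n) ->
  6 * kappa m1 + m1 + 12 * T * d.+1 <= N ->
  forall V G, G `<=` Kgraph V -> separators_geq N V G -> r G = r (Kgraph V).
Proof.
move=> km1 leN V; have leTN : T.*2 <= N by move: leN; clear; nia.
 have [n] := ubnP #|` V|; elim: n V => // n IHn V ltV G sG sepG.
have [H [sGH sH <- clH]] := exists_closed M sG.
have {}sepG := separators_geq_mono sGH sepG.
apply/eqP; rewrite eqn_leq grank_mono //= leqNgt; apply/negP => ltH.
have [e eK eH] : exists2 e, e \in Kgraph V & e \notin H.
  apply: contrapT => nex; move: ltH; rewrite ltnNge grank_mono //.
  by apply/fsubsetP => e eK; apply: contrapT => /negP eH; apply: nex; exists e.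
have leV : N.+2 <= #|` V|.
  move: eK eH => /KgraphP[x [y [xV yV ne ->]]]; exact: separators_geq_card.
have deg v : v \in V -> N <= #|` nbhd H V v|.
  by move=> vV; apply: separators_geq_degree => //; lia.
have [[v vV simpl]|nosimpl] := pselect (exists2 v, v \in V & forall x y, x \in V -> y \in V ->
    x != y -> mkedge v x \in H -> mkedge v y \in H -> mkedge x y \in H).
  have cV : #|` V| = #|` V `\ v|.+1 by rewrite (cardfsD1 v V) vV.
  have := IHn (V `\ v) ltac:(lia) _ (fsubsetIr H _) (separators_geq_simplicial vV simpl sepG).
  set V' := V `\ v => rH'; pose A := nbhd H V v.
  have vV' : v \notin V' by rewrite !inE eqxx.
  have sA : A `<=` V'.
    apply/fsubsetP => u; rewrite in_nbhd !inE => /andP[-> vu]; rewrite andbT.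
    by have := fsubsetP sH _ vu; rewrite mkedge_Kgraph eq_sym => /and3P[].
  have leA := deg v vV.
  have := grank_Kgraph_star T_gt1 disAB0 cardA0 cardB0 rigid0 vV' sA.
  rewrite -cV => /(_ ltac:(rewrite /A; lia) ltac:(rewrite /V'; lia)) star.
  (* By induction [H] without [v] has the rank of the clique on [V'], so attaching [v] gains at
     least as much as over that clique. *)
  have := grank_submodD M (biclique [fset v] A) (fsubsetIr H (Kgraph V')).
  rewrite star rH' -kappaE => le.
  suff : r (H `&` Kgraph V' `|` biclique [fset v] A) <= r H by lia.
  rewrite grank_mono // fsubUset fsubsetIl; apply/fsubsetP => e' /bicliqueP[a [b []]].
  by rewrite in_fset1 => /eqP->; rewrite in_nbhd => /andP[_ vb] ->.
have : (6 * d + 1) * #|` V| <= 6 * r H.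
  apply: (closed_rank_bound (N := N)) => //; first by lia.
  move=> v vV; apply: contrapT => nxy; apply: nosimpl; exists v => // x y xV yV ne vx vy.
  apply: contrapT => /negP nH; apply: nxy; exists x, y.
  by split=> //; rewrite in_nbhd ?xV ?yV.
(* With [n] the size of [V], these bounds give [(6 * d + 1) * n < 6 * kappa m1 + 6 * d * n], hence
   [n < 6 * kappa m1 <= N], contrary to [leV]. *)
have := km1 #|` V| ltac:(lia); move: ltH; rewrite kappaE; nia.
Qed.

End Main.

Theorem lovasz_yemini_of_biclique (M : graph_matroid_family) (T : nat) (A B : {fset nat}) :
  1 < T -> [disjoint A & B] -> #|` A| = T -> #|` B| = T ->
  grank M (biclique A B) = grank M (Kgraph (A `|` B)) ->
  lovasz_yemini (gmf_ind M).
Proof.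
move=> T1 dAB cA cB rig.
have [d [m1 [dP km1]]] := exists_dimension T1 dAB cA cB rig.
exists (6 * kappa M m1 + m1 + 12 * T * d.+1)%N => G sG conn; apply/rigidE => //.
apply: (separators_geq_rigid T1 dAB cA cB rig dP km1 (leqnn _)).
  exact: sub_Kgraph_verts.
exact: c_connected_separators.
Qed.

(** * Decomposing bicliques *)

Lemma c_connected_leq c c' G : c' <= c -> c_connected c G -> c_connected c' G.
Proof.
move=> le [lt conn]; split=> [|X sX ltX]; first exact: leq_ltn_trans lt.
by apply: conn => //; exact: leq_trans le.
Qed.

Section BicliqueDecomposition.
Variables K c : nat.
(** Parity and [label] together have period [2 * K], so any [T] consecutive numbers contain exactly
    [c] with a given parity and a given label below [K]. *)
Let T := (2 * K * c)%N.

Definition label (u : nat) := u./2 %% K.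

(* In colour [j] the vertices labelled [j] are hubs: a low vertex sees the high hubs of
   the opposite parity, a high vertex sees the low hubs of its own parity, and all low
   hubs see all high hubs. *)
Definition colour (e : edge) := if odd e.1 == odd e.2 then label e.1 else label e.2.

Definition lowside := [fset u in iota 0 T].
Definition highside := [fset u in iota T T].

Lemma in_lowside u : (u \in lowside) = (u < T).
Proof. by rewrite in_fset /= mem_iota. Qed.

Lemma in_highside u : (u \in highside) = (T <= u < T.*2).
Proof. by rewrite in_fset /= mem_iota addnn. Qed.

Lemma disjoint_sides : [disjoint lowside & highside].
Proof. by apply/fdisjointP => u; rewrite in_lowside in_highside; lia. Qed.

Definition colour_class j := [fset e in biclique lowside highside | colour e == j].

Lemma mem_colour_class j (a b : nat) :
  ((a, b) \in colour_class j) = [&& a < T, T <= b < T.*2 & colour (a, b) == j].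
Proof.
rewrite in_fset /= inE /= andbA; congr andb; apply/bicliqueP/idP.
  case=> x [y []]; rewrite in_lowside in_highside /mkedge => ? ? [-> ->]; lia.
move=> ab; exists a, b; rewrite in_lowside in_highside /mkedge.
by split; [lia | lia | congr pair; lia].
Qed.

Lemma simple_colour_class j : simple_graph (colour_class j).
Proof. by case=> a b; rewrite mem_colour_class /=; lia. Qed.

Hypotheses (K_gt0 : 0 < K) (c_gt0 : 0 < c).

(** Side [s], low for 0 and high for 1, has [c] hubs [h i] of the given label and parity, too many
    for [X] to contain them all. *)
Lemma exists_hub (X : {fset nat}) (s : nat) j (y : bool) : #|` X| < c -> j < K ->
  exists u, [/\ u \notin X, s * T <= u < s.+1 * T, label u = j & odd u = y].
Proof.
move=> ltX ltj; pose h i := (y + (j + K * (s * c + i)).*2)%N.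
have injh : injective h.
  move=> i i' /addnI/double_inj/addnI/eqP; rewrite eqn_pmul2l // eqn_add2l.
  by move/eqP.
have [i lti hX] : exists2 i, i < c & h i \notin X.
  apply: contrapT => nex; move: ltX; rewrite ltnNge => /negP; apply.
  rewrite -[c](size_iota 0) -(size_map h); apply: (@uniq_leq_size _ (map h (iota 0 c)) X).
    by rewrite map_inj_uniq ?iota_uniq.
  move=> _ /mapP[i + ->]; rewrite mem_iota => lti; apply: contrapT => /negP hX.
  by apply: nex; exists i.
exists (h i); split=> //.
- rewrite /h /T; have : K * i.+1 <= K * c by rewrite leq_mul2l lti orbT.
  by case: (y) => /=; nia.
- by rewrite /label /h half_bit_double -modnDmr modnMr addn0 modn_small.
- by rewrite /h oddD odd_double addbF oddb.
Qed.

Section Class.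
Variable j : nat.
Hypothesis ltjK : j < K.
Local Notation G := (colour_class j).
Local Notation linked x y := (((x, y) \in G) || ((y, x) \in G)).

Lemma linked_hub (X : {fset nat}) u : #|` X| < c -> u < T.*2 ->
  exists h, [/\ h \notin X, h < T.*2, label h = j & linked u h].
Proof.
move=> ltX ltu; have [uT|uT] := ltnP u T.
  have [h [hX hT lh oh]] := exists_hub 1 (~~ odd u) ltX ltjK.
  exists h; split=> //; first by lia.
  apply/orP; left; rewrite mem_colour_class uT /colour /= oh lh.
  by case: (odd u) => /=; rewrite eqxx; lia.
have [h [hX hT lh oh]] := exists_hub 0 (odd u) ltX ltjK.
exists h; split=> //; first by lia.
by apply/orP; right; rewrite mem_colour_class /colour /= oh lh !eqxx; lia.
Qed.

Lemma linked_hubs a b : a < T -> T <= b < T.*2 -> label a = j -> label b = j ->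
  linked a b.
Proof.
move=> aT bT la lb; rewrite mem_colour_class aT bT /colour /= la lb.
by case: ifP; rewrite eqxx.
Qed.

Lemma linkedC x y : linked x y = linked y x.
Proof. by rewrite orbC. Qed.

Lemma verts_colour_class : verts G = lowside `|` highside.
Proof.
have inU u : (u \in lowside `|` highside) = (u < T.*2).
  by rewrite in_fsetU in_lowside in_highside; lia.
apply/eqP; rewrite eqEfsubset; apply/andP; split.
  by apply/verts_subP => -[a b]; rewrite mem_colour_class !inU /=; lia.
apply/fsubsetP => u; rewrite inU => ltu.
have [|h [_ _ _ uh]] := @linked_hub fset0 u _ ltu; first by rewrite cardfs0.
have /verts_subP H := fsubset_refl (verts G).
by case/orP: uh => /H[].
Qed.

(** After deletion of fewer than [c] vertices every remaining vertex still sees a hub, and the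
    remaining hubs stay connected with each other. *)
Lemma colour_class_connected : c_connected c G.
Proof.
rewrite /c_connected verts_colour_class; split.
  have := cardfsUI lowside highside; rewrite !card_iota_fset.
  by move/eqP: disjoint_sides => ->; rewrite cardfs0 /T; nia.
move=> X _ ltX u v; rewrite !in_fsetD !in_fsetU !in_lowside !in_highside.
move=> /andP[uX uT] /andP[vX vT].
have [h [hX hT lh uh]] := linked_hub ltX (ltac:(lia) : u < T.*2).
have [h' [hX' hT' lh' vh']] := linked_hub ltX (ltac:(lia) : v < T.*2).
have [p pathp lastp] : exists2 p, path (adj_avoid G X) h p & last h p = h'.
  have opp x y : x \notin X -> y \notin X -> x < T -> T <= y < T.*2 -> label x = j ->
      label y = j -> adj_avoid G X x y /\ adj_avoid G X y x.
    move=> xX yX xT yT lx ly; have xy := linked_hubs xT yT lx ly.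
    by rewrite /adj_avoid [X in _ /\ (X && _)]linkedC xy xX yX.
  (* Hubs on the same side are joined through a surviving hub of the other side, the low [a] or the
     high [b]. *)
  have [a [aX aT la _]] := exists_hub 0 false ltX ltjK.
  have [b [bX bT lb _]] := exists_hub 1 false ltX ltjK.
  have [hlt|hge] := ltnP h T; have [hlt'|hge'] := ltnP h' T.
  - have [hb _] := opp h b hX bX hlt ltac:(lia) lh lb.
    have [_ bh'] := opp h' b hX' bX hlt' ltac:(lia) lh' lb.
    by exists [:: b; h'] => //=; rewrite hb bh'.
  - have [hh' _] := opp h h' hX hX' hlt ltac:(lia) lh lh'.
    by exists [:: h'] => //=; rewrite hh'.
  - have [_ hh'] := opp h' h hX' hX hlt' ltac:(lia) lh' lh.
    by exists [:: h'] => //=; rewrite hh'.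
  - have [_ ha] := opp a h aX hX ltac:(lia) ltac:(lia) la lh.
    have [ah' _] := opp a h' aX hX' ltac:(lia) ltac:(lia) la lh'.
    by exists [:: a; h'] => //=; rewrite ha ah'.
exists (h :: rcons p v); split; last by rewrite /= last_rcons.
by rewrite /= rcons_path pathp lastp /adj_avoid uh hX linkedC vh' vX.
Qed.

End Class.
End BicliqueDecomposition.

(** * Rigidity of a union by decomposition *)

Section UnionBiclique.
Variables (k : nat) (Ms : 'I_k -> graph_matroid_family) (V : {fset nat}) (G : {fset edge}).
Variables (chi : edge -> nat) (Gs : 'I_k -> {fset edge}).
Hypotheses (sG : G `<=` Kgraph V) (sGs : forall i, Gs i `<=` G).
Hypothesis chiGs : forall i e, e \in Gs i -> chi e = i.
Hypothesis rigidGs : forall i, grank (Ms i) (Gs i) = grank (Ms i) (Kgraph V).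

(** On the clique the rank of the union is at most the sum of the ranks of the [Ms i]. Bases of the
    [Gs i] attain this sum inside [G], and [chi] certifies that they are disjoint. *)
Lemma union_rigid_of_decomposition :
  grank (union_family Ms) G = grank (union_family Ms) (Kgraph V).
Proof.
have sG' : simple_graph G := simple_sub (@simple_Kgraph V) sG.
apply/eqP; rewrite eqn_leq grank_mono //=.
have [J [sJ iJ cJ]] := mrank_base (gind0 _) (@gind_aug (union_family Ms)) (Kgraph V).
rewrite {1}/grank -cJ.
have [psi [psik ipsi]] : exists phi : edge -> nat, (forall e, e \in J -> phi e < k) /\
    forall i : 'I_k, gmf_ind (Ms i) (Kgraph V) [fset e in J | phi e == i].
  by apply/union_ind_colour => //; apply/(gindE (union_family Ms)).
have /choice[Is HIs] : forall i, exists I : {fset edge},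
    [/\ I `<=` Gs i, gind (Ms i) I & #|` I| = grank (Ms i) (Kgraph V)].
  by move=> i; rewrite -rigidGs; exact: (mrank_base (gind0 _) (@gind_aug (Ms i))).
pose I := \bigcup_(i <- enum 'I_k) Is i.
have sIG : I `<=` G.
  apply/bigfcupsP => i _ _; have [sI _ _] := HIs i; exact: fsubset_trans (sGs i).
have iI : gind (union_family Ms) I.
  suff /(gindE (union_family Ms) I sG')[] : gmf_ind (union_family Ms) G I by [].
  exists Is; split=> // i; have [sI iIs _] := HIs i.
  by apply/gindE => //; split=> //; exact: fsubset_trans (sGs i).
apply: leq_trans (leq_card_mrank sIG iI).
have inI e : e \in I -> chi e < k.
  by case/bigfcupP => i _; have [sI _ _] := HIs i => /(fsubsetP sI)/chiGs->.
rewrite (card_colour_classes psik) (card_colour_classes inI); apply: leq_sum => i _.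
have [sI _ cI] := HIs i.
apply: (@leq_trans #|` Is i|).
  have /(gindE _ _ (@simple_Kgraph V))[iJi sJi] := ipsi i.
  by rewrite cI leq_card_mrank.
apply: fsubset_leq_card; apply/fsubsetP => e ei; rewrite in_fset /= inE /=.
rewrite (chiGs (fsubsetP sI e ei)) eqxx andbT; apply/bigfcupP.
by exists i; rewrite ?mem_enum.
Qed.

End UnionBiclique.

Theorem theorem3p18 (k : nat) (Ms : 'I_k -> graph_matroid_family) :
  (forall i, lovasz_yemini (gmf_ind (Ms i))) ->
  lovasz_yemini (union_ind Ms).
Proof.
(* The successor makes [c] positive. Likewise [k.+1] colours are taken to have at least one when
   [k = 0]; the last class is assigned to no family. *)
move=> /choice[cs Hcs]; pose c := (\max_i cs i).+1.
have c_gt0 : 0 < c by []. have K_gt0 : 0 < k.+1 by [].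
apply: (@lovasz_yemini_of_biclique (union_family Ms) (2 * k.+1 * c)
  (lowside k.+1 c) (highside k.+1 c)).
- by rewrite /c; nia.
- exact: disjoint_sides.
- exact: card_iota_fset.
- exact: card_iota_fset.
have sub j : colour_class k.+1 c j `<=` biclique (lowside k.+1 c) (highside k.+1 c).
  by apply/fsubsetP => e; rewrite in_fset /= inE => /andP[].
apply: (@union_rigid_of_decomposition _ _ _ _ (colour k.+1) (fun i => colour_class k.+1 c i)).
- by rewrite biclique_Kgraph ?fsubsetUl ?fsubsetUr ?disjoint_sides.
- by move=> i.
- by move=> i e; rewrite in_fset /= inE => /andP[_ /eqP].
move=> i; have lti : i < k.+1 by apply: ltnW; rewrite ltnS.
have sG := @simple_colour_class k.+1 c i.
(* Each colour class has all vertices of the biclique, so its rigidity refers to the same clique. *)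
rewrite -(verts_colour_class K_gt0 c_gt0 lti); apply/rigidE => //; apply: Hcs => //.
apply: c_connected_leq (colour_class_connected K_gt0 c_gt0 lti).
by rewrite /c leqW // leq_bigmax.
Qed.
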